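(* Let $n\geq 1$. A function $\mathcal{N}:L_n([0,1])\to L_n([0,1])$ is an $n$-dimensional strong fuzzy negation if and only if there exists an $n$-dimensional automorphism $\varphi$ such that $\mathcal{N}=\mathcal{N}_S^{\varphi}$, i.e. $\mathcal{N}(\mathbf{x})=\varphi^{-1}(\mathcal{N}_S(\varphi(\mathbf{x})))$ for all $\mathbf{x}\in L_n([0,1])$.
   Context: $L_n([0,1])=\{(x_1,\ldots,x_n)\in[0,1]^n : x_1\leq\cdots\leq x_n\}$, with projections $\pi_i(x_1,\ldots,x_n)=x_i$ and the componentwise order. For $x\in[0,1]$, $/x/=(x,\ldots,x)$. An $n$-dimensional fuzzy negation is a function $\mathcal{N}:L_n([0,1])\to L_n([0,1])$ with $\mathcal{N}(/0/)=/1/$, $\mathcal{N}(/1/)=/0/$ and $\mathcal{N}(\mathbf{x})\geq\mathcal{N}(\mathbf{y})$ whenever $\mathbf{x}\leq\mathbf{y}$; it is strong if $\mathcal{N}(\mathcal{N}(\mathbf{x}))=\mathbf{x}$ for all $\mathbf{x}$. The standard one is $\mathcal{N}_S(\mathbf{x})=(1-\pi_n(\mathbf{x}),1-\pi_{n-1}(\mathbf{x}),\ldots,1-\pi_1(\mathbf{x}))$. An $n$-dimensional automorphism is a bijection $\varphi:L_n([0,1])\to L_n([0,1])$ such that $\mathbf{x}\leq\mathbf{y}$ iff $\varphi(\mathbf{x})\leq\varphi(\mathbf{y})$. *)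

(* Defs.v *)
From HB Require Import structures.
From mathcomp Require Import all_boot all_order all_algebra.
From mathcomp Require Import reals.

Set Implicit Arguments.
Unset Strict Implicit.
Unset Printing Implicit Defensive.

Import Order.TTheory GRing.Theory Num.Theory.

Local Open Scope ring_scope.

Definition in_Ln (R : realType) (n : nat) (x : n.-tuple R) : bool :=
  all (fun t : R => 0 <= t <= 1) x && sorted <=%R x.

Record Ln (R : realType) (n : nat) := MkLn {
  Ln_tuple :> n.-tuple R;
  Ln_tupleP : in_Ln Ln_tuple }.

HB.instance Definition _ (R : realType) (n : nat) :=
  [isSub of Ln R n for @Ln_tuple R n].
HB.instance Definition _ (R : realType) (n : nat) :=
  [Choice of Ln R n by <:].

(* Indices are zero-based: proj i is the (i+1)-th projection. *)
Definition proj (R : realType) (n : nat) (i : 'I_n) (x : Ln R n) : R :=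
  tnth x i.

Definition Ln_le (R : realType) (n : nat) (x y : Ln R n) : bool :=
  [forall i, proj i x <= proj i y].

Fact Ln_le_refl (R : realType) (n : nat) : reflexive (@Ln_le R n).
Proof. by move=> x; apply/forallP => i. Qed.

Fact Ln_le_anti (R : realType) (n : nat) : antisymmetric (@Ln_le R n).
Proof.
move=> x y /andP[/forallP lexy /forallP leyx].
apply/val_inj/eq_from_tnth => i.
by apply/le_anti/andP; split; [exact: lexy | exact: leyx].
Qed.

Fact Ln_le_trans (R : realType) (n : nat) : transitive (@Ln_le R n).
Proof.
move=> y x z /forallP lexy /forallP leyz; apply/forallP => i.
exact: le_trans (lexy i) (leyz i).
Qed.

Fact Ln_display : Order.disp_t. Proof. exact: Order.Disp tt tt. Qed.

(* Since the display is not ring_display, the order is written (x <= y)%O. *)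
HB.instance Definition _ (R : realType) (n : nat) :=
  Order.Le_isPOrder.Build Ln_display (Ln R n)
    (@Ln_le_refl R n) (@Ln_le_anti R n) (@Ln_le_trans R n).

Lemma Ln_leP (R : realType) (n : nat) (x y : Ln R n) :
  reflect (forall i, proj i x <= proj i y) (x <= y)%O.
Proof. exact: forallP. Qed.

Lemma in_LnP (R : realType) (n : nat) (x : n.-tuple R) :
  reflect ((forall i, 0 <= tnth x i <= 1) /\
           (forall i j : 'I_n, (i <= j)%N -> tnth x i <= tnth x j))
          (in_Ln x).
Proof.
apply: (iffP andP) => -[x01 xs]; split.
- by move=> i; exact: (all_tnthP x01 i).
- move=> i j leij; rewrite !(tnth_nth 0).
  by apply: (sorted_leq_nth le_trans le_refl) => //; rewrite inE size_tuple.
- exact/all_tnthP.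
- apply/(sortedP 0) => i; rewrite size_tuple => lti.
  have := xs (Ordinal (ltnW lti)) (Ordinal lti) (leqnSn i).
  by rewrite !(tnth_nth 0).
Qed.

Fact diag_subproof (R : realType) (n : nat) (t : R) (t01 : 0 <= t <= 1) :
  in_Ln [tuple t | i < n].
Proof. by apply/in_LnP; split=> *; rewrite !tnth_mktuple. Qed.

(* The constant vector /t/. *)
Definition diag (R : realType) (n : nat) (t : R) (t01 : 0 <= t <= 1) : Ln R n :=
  MkLn (diag_subproof n t01).

Fact zero_in01 (R : realType) : 0 <= (0 : R) <= 1.
Proof. by rewrite lexx ler01. Qed.

Fact one_in01 (R : realType) : 0 <= (1 : R) <= 1.
Proof. by rewrite lexx ler01. Qed.

Definition Ln_zero (R : realType) (n : nat) : Ln R n := diag n (zero_in01 R).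
Definition Ln_one (R : realType) (n : nat) : Ln R n := diag n (one_in01 R).

Definition fuzzy_negation (R : realType) (n : nat) (N : Ln R n -> Ln R n) :
    Prop :=
  [/\ N (Ln_zero R n) = Ln_one R n,
      N (Ln_one R n) = Ln_zero R n
    & forall x y : Ln R n, (x <= y)%O -> (N x >= N y)%O].

Definition strong_fuzzy_negation (R : realType) (n : nat)
    (N : Ln R n -> Ln R n) : Prop :=
  fuzzy_negation N /\ forall x, N (N x) = x.

Fact standard_negation_subproof (R : realType) (n : nat) (x : Ln R n) :
  in_Ln [tuple 1 - proj (rev_ord i) x | i < n].
Proof.
have /in_LnP[x01 xs] := Ln_tupleP x.
apply/in_LnP; split=> [i|i j leij]; rewrite !tnth_mktuple.
  by have /andP[x0 x1] := x01 (rev_ord i); rewrite subr_ge0 x1 gerBl.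
by rewrite lerB // xs //= leq_sub2l.
Qed.

Definition standard_negation (R : realType) (n : nat) (x : Ln R n) : Ln R n :=
  MkLn (standard_negation_subproof x).

Definition Ln_automorphism (R : realType) (n : nat) (phi : Ln R n -> Ln R n) :
    Prop :=
  bijective phi /\ forall x y : Ln R n, (x <= y)%O <-> (phi x <= phi y)%O.

(* N is the conjugate M^phi; phi_inv is the (unique) two-sided inverse of phi. *)
Definition is_conjugate (R : realType) (n : nat)
    (M phi N : Ln R n -> Ln R n) : Prop :=
  exists phi_inv : Ln R n -> Ln R n,
    [/\ cancel phi phi_inv, cancel phi_inv phi
      & forall x, N x = phi_inv (M (phi x))].

(* Main.v *)
Require Import Defs.
From mathcomp Require Import all_boot all_order all_algebra.
From mathcomp Require Import classical_sets reals lra.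

(** Composing a strong negation with the standard one gives an automorphism f
    of L_n. The join-irreducible elements of L_n are the steps (0,..,0,t,..,t),
    and f preserves the number of leading zeros of a nonzero step, by downward
    induction on that number k: a nonzero step below a step with k zeros has at
    least k zeros, so those with at most k zeros form a chain, whereas below a
    step with l < k zeros the steps with l and with k zeros do not. Hence f acts
    on all coordinates by one and the same function, and
    N x = (nu x_n, .., nu x_1) for a strong negation nu of [0,1]. Trillas'
    construction, based on the fixed point e of nu, conjugates nu to 1 - t. *)

Set Implicit Arguments.
Unset Strict Implicit.
Unset Printing Implicit Defensive.

Import Order.TTheory GRing.Theory Num.Theory.
Local Open Scope ring_scope.

(** * Coordinates, constant vectors and the standard negation *)

Lemma proj01 (R : realType) (n : nat) (x : Ln R n) i : 0 <= proj i x <= 1.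
Proof. by have /in_LnP[+ _] := Ln_tupleP x; apply. Qed.

Lemma proj_mono (R : realType) (n : nat) (x : Ln R n) (i j : 'I_n) :
  (i <= j)%N -> proj i x <= proj j x.
Proof. by have /in_LnP[_] := Ln_tupleP x; apply. Qed.

Lemma Ln_eqP (R : realType) (n : nat) (x y : Ln R n) :
  (forall i, proj i x = proj i y) -> x = y.
Proof. by move=> xy; apply/val_inj/eq_from_tnth. Qed.

(* Junk value: [Ln_zero] when [f] is not nondecreasing with values in [0,1]. *)
Definition mkLn (R : realType) (n : nat) (f : 'I_n -> R) : Ln R n :=
  insubd (Ln_zero R n) [tuple f i | i < n].

Lemma proj_mkLn (R : realType) (n : nat) (f : 'I_n -> R) i :
  (forall i, 0 <= f i <= 1) ->
  (forall i j : 'I_n, (i <= j)%N -> f i <= f j) ->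
  proj i (mkLn f) = f i.
Proof.
move=> f01 fh; have Pf : in_Ln [tuple f i | i < n].
  by apply/in_LnP; split=> *; rewrite !tnth_mktuple; auto.
rewrite /proj /mkLn -[Ln_tuple _]/(val _) val_insubd Pf.
by rewrite tnth_mktuple.
Qed.

Lemma proj_diag (R : realType) (n : nat) (t : R) (t01 : 0 <= t <= 1) (i : 'I_n) :
  proj i (diag n t01) = t.
Proof. by rewrite /proj tnth_mktuple. Qed.

Lemma Ln_zero_le (R : realType) (n : nat) (x : Ln R n) : (Ln_zero R n <= x)%O.
Proof. by apply/Ln_leP => i; rewrite proj_diag; case/andP: (proj01 x i). Qed.

Lemma le_Ln_one (R : realType) (n : nat) (x : Ln R n) : (x <= Ln_one R n)%O.
Proof. by apply/Ln_leP => i; rewrite proj_diag; case/andP: (proj01 x i). Qed.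

Lemma proj_standard_negation (R : realType) (n : nat) (x : Ln R n) i :
  proj i (standard_negation x) = 1 - proj (rev_ord i) x.
Proof. by rewrite /proj tnth_mktuple. Qed.

Lemma standard_negationK (R : realType) (n : nat) :
  involutive (@standard_negation R n).
Proof.
by move=> x; apply: Ln_eqP => i; rewrite !proj_standard_negation rev_ordK subKr.
Qed.

Lemma standard_negation_anti (R : realType) (n : nat) (x y : Ln R n) :
  (x <= y)%O -> (standard_negation y <= standard_negation x)%O.
Proof.
move=> /Ln_leP lexy; apply/Ln_leP => i.
by rewrite !proj_standard_negation lerB.
Qed.

(** * Steps and join-irreducible elements *)

Definition step (R : realType) (n : nat) (k : 'I_n) (t : R) : Ln R n :=
  mkLn (fun i : 'I_n => if (k <= i)%N then t else 0).

Lemma proj_step (R : realType) (n : nat) (k i : 'I_n) (t : R) :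
  0 <= t <= 1 -> proj i (step k t) = if (k <= i)%N then t else 0.
Proof.
move=> t01; rewrite proj_mkLn // => [j|j l lejl].
  by case: ifP => _ //; rewrite lexx ler01.
case: ifP => [lekj|_]; first by rewrite (leq_trans lekj lejl).
by case: ifP => _ //; case/andP: t01.
Qed.

(** The coordinates of [x] from [k] on are at least [proj k x], so coordinate [k] alone decides.
    Steps thus recover the projections from the order. *)
Lemma step_le (R : realType) (n : nat) (k : 'I_n) (t : R) (x : Ln R n) :
  0 <= t <= 1 -> (step k t <= x)%O = (t <= proj k x).
Proof.
move=> t01; apply/Ln_leP/idP => [/(_ k)|letx i]; first by rewrite proj_step ?leqnn.
rewrite proj_step //; case: ifP => [leki|_]; last by case/andP: (proj01 x i).
exact: le_trans letx (proj_mono _ leki).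
Qed.

Lemma step0 (R : realType) (n : nat) (k l : 'I_n) : step k 0 = step l (0 : R).
Proof.
apply: Ln_eqP => i; rewrite !proj_step ?lexx ?ler01 //.
by do 2!case: ifP.
Qed.

Lemma step0_le (R : realType) (n : nat) (k : 'I_n) (x : Ln R n) :
  (step k 0 <= x)%O.
Proof. by rewrite step_le ?lexx ?ler01 //; case/andP: (proj01 x k). Qed.

Lemma step_inj (R : realType) (n : nat) (k l : 'I_n) (t s : R) :
  0 <= t <= 1 -> 0 <= s <= 1 -> t != 0 -> step k t = step l s -> k = l.
Proof.
move=> t01 s01 t0 E.
have := congr1 (proj k) E; have := congr1 (proj l) E.
rewrite !proj_step // !leqnn; case: ifP => [kl ts|_ s0].
  case: ifP => [lk _|_ /eqP]; last by rewrite (negPf t0).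
  by apply/val_inj/anti_leq; rewrite kl lk.
by case: ifP => _ /eqP; rewrite -?s0 (negPf t0).
Qed.

(** That [x] is the join of [y] and [z] is expressed through the order alone, so order isomorphisms
    preserve the notion. The zero vector counts as irreducible. *)
Definition join_irreducible (R : realType) (n : nat) (x : Ln R n) : Prop :=
  forall y z : Ln R n, (y <= x)%O -> (z <= x)%O ->
    (forall w : Ln R n, (y <= w)%O -> (z <= w)%O -> (x <= w)%O) ->
  (x <= y)%O \/ (x <= z)%O.

(** The pointwise maximum [w] bounds [y] and [z], hence the step; at coordinate [k] it equals one of
    the two. *)
Lemma step_irreducible (R : realType) (n : nat) (k : 'I_n) (t : R) :
  0 <= t <= 1 -> join_irreducible (step k t).
Proof.
move=> t01 y z _ _ H.
pose w := mkLn (fun i => Num.max (proj i y) (proj i z)).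
have pw i : proj i w = Num.max (proj i y) (proj i z).
  rewrite proj_mkLn // => [j|j l lejl].
    by rewrite maxEle; case: ifP => _; exact: proj01.
  by rewrite ge_max !le_max !(proj_mono _ lejl) orbT.
have := H w; rewrite !step_le // pw le_max => K; apply/orP/K.
  by apply/Ln_leP => i; rewrite pw le_max lexx.
by apply/Ln_leP => i; rewrite pw le_max lexx orbT.
Qed.

(** For each [j], [x] is the join of [y], which is [x] with the coordinates up to [j] erased, and
    [z], which is [x] capped at its [j]-th value. If [x] is below [y], this value is 0; if below
    [z], it is the largest one, [m]. *)
Lemma irreducible_step (R : realType) (n : nat) (x : Ln R n.+1) :
  join_irreducible x ->
  exists (k : 'I_n.+1) (t : R), [/\ 0 <= t <= 1 & x = step k t].
Proof.
move=> xJ; set m := proj ord_max x.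
have lem i : proj i x <= m by apply: proj_mono; rewrite -ltnS.
have H j : proj j x = 0 \/ proj j x = m.
  pose y := mkLn (fun i : 'I_n.+1 => if (i <= j)%N then 0 else proj i x).
  pose z := mkLn (fun i : 'I_n.+1 => Num.min (proj i x) (proj j x)).
  have py i : proj i y = if (i <= j)%N then 0 else proj i x.
    rewrite proj_mkLn // => [l|l p lelp].
      by case: ifP => _; rewrite ?lexx ?ler01 ?proj01.
    case: ifP => lj; case: ifP => pj //; rewrite ?proj_mono //.
      by case/andP: (proj01 x p).
    by rewrite (leq_trans lelp pj) in lj.
  have pz i : proj i z = Num.min (proj i x) (proj j x).
    rewrite proj_mkLn // => [l|l p lelp].
      by rewrite minEle; case: ifP => _; exact: proj01.
    by rewrite le_min !ge_min lexx (proj_mono _ lelp) orbT.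
  case: (xJ y z).
  - apply/Ln_leP => i; rewrite py; case: ifP => // _.
    by case/andP: (proj01 x i).
  - by apply/Ln_leP => i; rewrite pz ge_min lexx.
  - move=> w /Ln_leP yw /Ln_leP zw; apply/Ln_leP => i.
    have := yw i; have := zw i; rewrite py pz; case: ifP => // ij.
    by rewrite (min_idPl (proj_mono x ij)).
  - move=> /Ln_leP/(_ j); rewrite py leqnn => xj0; left.
    by apply/le_anti; rewrite xj0; case/andP: (proj01 x j).
  - move=> /Ln_leP/(_ ord_max); rewrite pz le_min => /andP[_ mx]; right.
    by apply/le_anti; rewrite mx lem.
pose P := [pred i : 'I_n.+1 | proj i x == m].
have Pmax : P ord_max by rewrite /P /=.
case: (arg_minnP (fun i : 'I_n.+1 => i : nat) Pmax) => k /eqP Pk kmin.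
exists k, m; split; first exact: proj01.
apply: Ln_eqP => i; rewrite proj_step ?proj01 //; case: ifP => [leki|/negP nki].
  by apply/le_anti; rewrite lem -Pk proj_mono.
by case: (H i) => // /eqP xim; case: nki; apply: kmin.
Qed.

Lemma irreducible_below_step (R : realType) (n : nat) (k : 'I_n.+1) (t : R)
    (y : Ln R n.+1) :
  0 <= t <= 1 -> join_irreducible y -> (y <= step k t)%O ->
  exists (l : 'I_n.+1) (s : R), [/\ (k <= l)%N, 0 <= s <= 1 & y = step l s].
Proof.
move=> t01 /irreducible_step[l [s [s01 ->]]]; rewrite step_le // proj_step //.
case: ifP => [lekl _|_ s0]; first by exists l, s.
(* The zero vector is a step at every level, so it may be relabelled with level [k]. *)
exists k, 0; rewrite lexx ler01; split=> //.
by have -> : s = 0 by [apply/le_anti; rewrite s0; case/andP: s01]; exact: step0.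
Qed.

(** * Order isomorphisms act by one function on all coordinates *)

Definition order_iso (R : realType) (n : nat) (f g : Ln R n -> Ln R n) : Prop :=
  [/\ cancel f g, cancel g f,
      {homo f : x y / (x <= y)%O} & {homo g : x y / (x <= y)%O}].

Lemma order_iso_sym (R : realType) (n : nat) (f g : Ln R n -> Ln R n) :
  order_iso f g -> order_iso g f.
Proof. by case. Qed.

Lemma order_iso_le (R : realType) (n : nat) (f g : Ln R n -> Ln R n) x y :
  order_iso f g -> (f x <= f y)%O = (x <= y)%O.
Proof.
by case=> fK gK fh gh; apply/idP/idP => [/gh|/fh //]; rewrite !fK.
Qed.

Lemma order_iso_irreducible (R : realType) (n : nat) (f g : Ln R n -> Ln R n) x :
  order_iso f g -> join_irreducible x -> join_irreducible (f x).
Proof.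
move=> iso xJ y z; have [fK gK _ _] := iso.
rewrite -[y]gK -[z]gK !(order_iso_le _ _ iso) => yx zx H.
by apply: xJ => // w yw zw; rewrite -(order_iso_le _ _ iso) H // (order_iso_le _ _ iso).
Qed.

Lemma order_iso_step (R : realType) (n : nat) (f g : Ln R n.+1 -> Ln R n.+1)
    (k : 'I_n.+1) (t : R) :
  order_iso f g -> 0 <= t <= 1 ->
  exists2 s : R, 0 <= s <= 1 & f (step k t) = step k s.
Proof.
(* Higher levels come first. The maps [f] and [g] are generalised so that the hypothesis also
   applies to the inverse. *)
have [m] := ubnP (n.+1 - k)%N.
elim: m f g k t => // m IHm f g k t ltm iso t01.
have IH f' g' (p : 'I_n.+1) (q : R) : order_iso f' g' -> (k < p)%N -> 0 <= q <= 1 ->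
    exists2 s : R, 0 <= s <= 1 & f' (step p q) = step p s.
  move=> iso' ltkp; apply: (IHm f' g') => //.
  apply: leq_trans (ltn_sub2l _ ltkp) _ => //.
have zero01 : 0 <= (0 : R) <= 1 by rewrite lexx ler01.
have [fK gK fh gh] := iso; have iso' := order_iso_sym iso.
have [t0|tN0] := eqVneq t 0.
  exists 0 => //; rewrite t0; apply/le_anti; rewrite step0_le andbT.
  by rewrite -[X in (_ <= X)%O]gK fh // step0_le.
have [l [s [s01 fE]]] := irreducible_step
  (order_iso_irreducible iso (step_irreducible (k := k) t01)).
have [s0|sN0] := eqVneq s 0; first by exists 0; rewrite // fE s0 (step0 _ l k).
case: (ltngtP k l) => [ltkl|ltlk|/val_inj kl]; last by exists s => //; rewrite fE kl.
  (* If the level rose to [l], the inverse would preserve level [l] and send the image back to a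
     step at [l], not at [k]. *)
  have [s' s'01] := IH g f l s iso' ltkl s01.
  by rewrite -fE fK => /step_inj kl; rewrite kl ?ltnn // in ltkl.
(* The preimages of the incomparable [step l (s / 2)] and [step k s] are steps
   below [step k t] on the same level [k], hence comparable. *)
have H (p : 'I_n.+1) (q : R) : (l <= p <= k)%N -> 0 <= q <= s ->
    exists2 q' : R, 0 <= q' <= 1 & g (step p q) = step k q'.
  move=> /andP[lp pk] /andP[q_ge0 qs].
  have q01 : 0 <= q <= 1 by rewrite q_ge0 (le_trans qs) //; case/andP: s01.
  have [q0|qN0] := eqVneq q 0.
    exists 0 => //; rewrite q0; apply/le_anti; rewrite step0_le andbT.
    by rewrite -[X in (_ <= X)%O]fK gh // step0_le.
  have le1 : (g (step p q) <= step k t)%O.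
    by rewrite -[X in (_ <= X)%O]fK gh // fE step_le // proj_step // lp.
  have [p' [q' [kp' q'01 gE]]] := irreducible_below_step t01
    (order_iso_irreducible iso' (step_irreducible (k := p) q01)) le1.
  (* A preimage at a level [p'] beyond [k] would be mapped by [f] to level [p'], whereas its image
     has level [p <= k]. *)
  move: kp'; rewrite leq_eqVlt => /orP[/eqP/val_inj kp'|kp'].
    by exists q' => //; rewrite gE kp'.
  have [q'' q''01] := IH f g p' q' iso kp' q'01.
  by rewrite -gE gK => /step_inj pp'; move: kp'; rewrite -pp' // ltnNge pk.
have s_gt0 : 0 < s by rewrite lt_neqAle eq_sym sN0; case/andP: s01.
(* The height [s / 2] is positive, hence above the zero at coordinate [l] of [step k s], and less
   than [s], which excludes the reverse comparison. *)
have s201 : 0 <= s / 2 <= 1 by case/andP: s01 => *; apply/andP; split; lra.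
have [||u u01 uE] := H l (s / 2); first by rewrite leqnn ltnW.
  by apply/andP; split; lra.
have [||v v01 vE] := H k s; first by rewrite leqnn ltnW.
  by rewrite lexx ltW.
have := le_total u v => /orP[uv|vu]; exfalso.
  have : (g (step l (s / 2)) <= g (step k s))%O.
    by rewrite uE vE step_le // proj_step // leqnn.
  rewrite (order_iso_le _ _ iso') step_le // proj_step // leqNgt ltlk /=; lra.
have : (g (step k s) <= g (step l (s / 2)))%O.
  by rewrite uE vE step_le // proj_step // leqnn.
rewrite (order_iso_le _ _ iso') step_le // proj_step // ltnW //; lra.
Qed.

Definition coord_fun (R : realType) (n : nat) (f : Ln R n.+1 -> Ln R n.+1)
  (t : R) : R := proj ord_max (f (step ord_max t)).

(** At equal heights the step at [ord_max] lies below the one at [k], which gives one inequality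
    between the image heights [r] and [s]. For the other, the preimage of [step ord_max s] is a
    last-level step below [step k t], so its height is at most [t]. *)
Lemma order_iso_step_coord (R : realType) (n : nat)
    (f g : Ln R n.+1 -> Ln R n.+1) (k : 'I_n.+1) (t : R) :
  order_iso f g -> 0 <= t <= 1 -> f (step k t) = step k (coord_fun f t).
Proof.
move=> iso t01; have kmax : (k <= @ord_max n)%N by rewrite -ltnS.
have [s s01 sE] := order_iso_step k iso t01.
have [r r01 rE] := order_iso_step ord_max iso t01.
rewrite sE /coord_fun rE proj_step // leqnn; congr step; apply/le_anti/andP; split.
  have [t' t'01 t'E] := order_iso_step ord_max (order_iso_sym iso) s01.
  have t'K : f (step ord_max t') = step ord_max s.
    by case: iso => _ gK _ _; rewrite -t'E gK.
  have : (f (step ord_max t') <= f (step k t))%O.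
    by rewrite t'K sE step_le // proj_step // kmax.
  rewrite (order_iso_le _ _ iso) step_le // proj_step // kmax => t't.
  have : (f (step ord_max t') <= f (step ord_max t))%O.
    by rewrite (order_iso_le _ _ iso) step_le // proj_step // leqnn.
  by rewrite t'K rE step_le // proj_step // leqnn.
have : (f (step ord_max t) <= f (step k t))%O.
  by rewrite (order_iso_le _ _ iso) step_le // proj_step // kmax.
by rewrite sE rE step_le // proj_step // kmax.
Qed.

(** The value [proj k x] is the largest [t] with [step k t] below [x], and [f] and [g] transport
    such steps in both directions. *)
Lemma order_iso_proj (R : realType) (n : nat) (f g : Ln R n.+1 -> Ln R n.+1)
    (k : 'I_n.+1) (x : Ln R n.+1) :
  order_iso f g -> proj k (f x) = coord_fun f (proj k x).
Proof.
move=> iso; have iso' := order_iso_sym iso; have [fK gK fh gh] := iso.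
have coord01 (h : Ln R n.+1 -> Ln R n.+1) t : 0 <= coord_fun h t <= 1 by exact: proj01.
have stepx (y : Ln R n.+1) : (step k (proj k y) <= y)%O by rewrite step_le ?proj01.
apply/le_anti/andP; split.
  have := gh _ _ (stepx (f x)).
  rewrite (order_iso_step_coord _ iso') ?proj01 // fK step_le //.
  set t' := coord_fun g _ => t'x.
  have : (step k t' <= step k (proj k x))%O.
    by rewrite step_le ?coord01 // proj_step ?proj01 // leqnn.
  move/fh; rewrite -(order_iso_step_coord _ iso') ?proj01 // gK.
  by rewrite (order_iso_step_coord _ iso) ?proj01 // step_le ?proj01 //
    proj_step // leqnn.
have := fh _ _ (stepx x).
by rewrite (order_iso_step_coord _ iso) ?proj01 // step_le.
Qed.

(** Two antitone involutions compose to an order isomorphism, whose inverse is the composite in the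
    other order. Undoing the standard negation reverses the indices. *)
Lemma strong_negation_coord (R : realType) (n : nat) (N : Ln R n.+1 -> Ln R n.+1) :
  strong_fuzzy_negation N ->
  exists nu : R -> R, forall k x, proj k (N x) = nu (proj (rev_ord k) x).
Proof.
case=> [[_ _ Nanti] NK].
have iso : order_iso (@standard_negation R n.+1 \o N) (N \o @standard_negation R n.+1).
  split=> [x|x|x y xy|x y xy] /=; rewrite ?standard_negationK ?NK //.
  - by rewrite standard_negationK.
  - exact/standard_negation_anti/Nanti.
  - exact/Nanti/standard_negation_anti.
exists (fun t => 1 - coord_fun (@standard_negation R n.+1 \o N) t) => k x.
by rewrite -(order_iso_proj _ _ iso) proj_standard_negation rev_ordK subKr.
Qed.

(** * Strong negations of the unit interval *)

(** The fixed point is the supremum [e] of the [t] with [t <= nu t]; a point midway between [e] and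
    [nu e] refutes either strict inequality. *)
Lemma negation_fixpoint (R : realType) (nu : R -> R) :
  (forall t, 0 <= t <= 1 -> 0 <= nu t <= 1) ->
  (forall t s, 0 <= t <= 1 -> 0 <= s <= 1 -> t <= s -> nu s <= nu t) ->
  (forall t, 0 <= t <= 1 -> nu (nu t) = t) ->
  exists2 e, 0 < e < 1 & nu e = e.
Proof.
move=> nu01 nuanti nuK.
pose A : set R := [set t | 0 <= t <= 1 /\ t <= nu t]%classic.
have A0 : A 0 by split; rewrite ?lexx ?ler01 //; case/andP: (nu01 0 (zero_in01 R)).
have Aub : ubound A 1 by move=> t [/andP[]].
have supA : has_sup A by split; [exists 0 | exists 1].
have Ale t : A t -> t <= sup A by move=> At; apply: sup_upper_bound.
set e := sup A in Ale.
have e01 : 0 <= e <= 1 by rewrite Ale //= sup_le_ub //; exists 0.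
have /andP[e0 e1] := e01; have /andP[ne0 ne1] := nu01 _ e01.
have fe : nu e = e.
  case: (ltgtP (nu e) e) => // [lt_nu_e|lt_e_nu]; exfalso.
    (* Both [c] and [nu c] lie below [e], so some [m] in [A] exceeds both, and then
       [m <= nu m <= nu c < m]. *)
    pose c := (nu e + e) / 2.
    have c01 : 0 <= c <= 1 by rewrite /c; apply/andP; split; lra.
    have ltcne : nu c < e.
      rewrite lt_neqAle -{2}(nuK _ e01) nuanti ?nu01 //; last by rewrite /c; lra.
      rewrite andbT; apply/eqP => E; have := nuK _ c01; rewrite E /c; lra.
    have ltmax : 0 < e - Num.max c (nu c) by rewrite subr_gt0 gt_max ltcne /c; lra.
    have [m [m01 mnu]] := sup_adherent ltmax supA.
    rewrite subKr gt_max => /andP[ltcm ltncm].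
    by have := nuanti c m c01 m01 (ltW ltcm); lra.
  (* Since [m] exceeds [e], it is not in [A], so [nu m < m]. Then [nu m] is in [A], hence at most
     [e], and applying [nu] gives [nu e <= m]. *)
  pose m := (e + nu e) / 2.
  have m01 : 0 <= m <= 1 by rewrite /m; apply/andP; split; lra.
  have nm : nu m < m.
    by rewrite ltNge; apply/negP => mnu; have := Ale m (conj m01 mnu); rewrite /m; lra.
  have le1 : nu m <= e by apply: Ale; split; rewrite ?nu01 // nuK // ltW.
  have := nuanti (nu m) e (nu01 _ m01) e01 le1; rewrite nuK // /m; lra.
(* If [e = 0], then [1 = nu (nu 1) <= nu e = 0]; if [e = 1], then [1 = nu e <= nu (nu 0) = 0]. *)
exists e => //; rewrite !lt_neqAle e0 e1 !andbT; apply/andP; split; apply/eqP => E.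
  have := nuanti e (nu 1) e01 (nu01 _ (one_in01 R)).
  by rewrite (nuK 1 (one_in01 R)) fe -E; have := nu01 _ (one_in01 R); lra.
have := nuanti (nu 0) e (nu01 _ (zero_in01 R)) e01.
by rewrite (nuK 0 (zero_in01 R)) fe E; have := nu01 _ (zero_in01 R); lra.
Qed.

Lemma trillas (R : realType) (nu : R -> R) :
  (forall t, 0 <= t <= 1 -> 0 <= nu t <= 1) ->
  (forall t s, 0 <= t <= 1 -> 0 <= s <= 1 -> t <= s -> nu s <= nu t) ->
  (forall t, 0 <= t <= 1 -> nu (nu t) = t) ->
  exists g h : R -> R,
   [/\ forall t, 0 <= t <= 1 -> [/\ 0 <= g t <= 1, h (g t) = t & g (nu t) = 1 - g t],
       forall t, 0 <= t <= 1 -> 0 <= h t <= 1 /\ g (h t) = t,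
       forall t s, 0 <= t <= 1 -> 0 <= s <= 1 -> t <= s -> g t <= g s
     & forall t s, 0 <= t <= 1 -> 0 <= s <= 1 -> t <= s -> h t <= h s].
Proof.
move=> nu01 nuanti nuK; have [e /andP[e0 e1] fe] := negation_fixpoint nu01 nuanti nuK.
have e01 : 0 <= e <= 1 by rewrite !ltW.
have nu_lt t : 0 <= t <= 1 -> e < t -> nu t < e.
  move=> t01 et; rewrite ltNge; apply/negP => le_e.
  by have := nuanti e (nu t) e01 (nu01 _ t01) le_e; rewrite nuK // fe leNgt et.
have nu_gt t : 0 <= t <= 1 -> t < e -> e < nu t.
  move=> t01 et; rewrite ltNge; apply/negP => le_e.
  by have := nuanti (nu t) e (nu01 _ t01) e01 le_e; rewrite nuK // fe leNgt et.
have half t : t <= e -> t / (2 * e) <= 2^-1.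
  by rewrite ler_pdivrMr; [lra | lra].
have divgt t : t < e -> t / (2 * e) < 2^-1.
  by rewrite ltr_pdivrMr; [lra | lra].
have div0 t : 0 <= t -> 0 <= t / (2 * e) by move=> ?; rewrite divr_ge0 //; lra.
have divle t s : t <= s -> t / (2 * e) <= s / (2 * e).
  by rewrite ler_pM2r // invr_gt0; lra.
have mulK t : 2 * e * (t / (2 * e)) = t by rewrite mulrC divfK //; apply/eqP; lra.
have Kmul t : 2 * e * t / (2 * e) = t by rewrite mulrC mulKf //; apply/eqP; lra.
have dive : e / (2 * e) = 2^-1 by rewrite -(Kmul 2^-1); congr (_ / _); lra.
(* On [[0, e]] the map is linear onto [[0, 1/2]]; beyond [e] the formula is forced by
   [g (nu t) = 1 - g t]. Both formulas give 1/2 at [e]. *)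
pose g t := if t <= e then t / (2 * e) else 1 - nu t / (2 * e).
(* The inverse of [g]: above 1/2 it is [nu (h (1 - u))]. *)
pose h u := if u <= 2^-1 then 2 * e * u else nu (2 * e * (1 - u)).
have le_e u : 0 <= u <= 1 -> u <= 2^-1 -> 0 <= 2 * e * u <= e.
  by move=> u01 u2; apply/andP; split; nra.
have lt_e u : 0 <= u <= 1 -> 2^-1 < u -> 0 <= 2 * e * (1 - u) < e.
  by move=> u01 u2; apply/andP; split; nra.
exists g, h; split.
- move=> t t01; have /andP[n0 n1] := nu01 _ t01; have /andP[t0 t1] := t01.
  rewrite /g; case: (leP t e) => [te|et].
    have t2 := half _ te; have t20 := div0 _ t0; split; first lra.
      by rewrite /h t2 mulK.
    case: (ltgtP t e) te => // [lt_te _|-> _]; last by rewrite fe lexx dive; lra.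
    by rewrite leNgt nu_gt // nuK.
  have ne := nu_lt _ t01 et; have n2 := divgt _ ne; have n20 := div0 _ n0.
  split; first lra.
    by rewrite /h ifF; [rewrite subKr mulK nuK | apply/negbTE; rewrite -ltNge; lra].
  by rewrite (ltW ne) subKr.
- move=> u u01; rewrite /h /g; case: (leP u 2^-1) => [u2|u2].
    by have /andP[h0 he] := le_e _ u01 u2; rewrite he Kmul; split=> //; lra.
  have /andP[h0 he] := lt_e _ u01 u2.
  have v01 : 0 <= 2 * e * (1 - u) <= 1 by lra.
  by rewrite nu01 // leNgt nu_gt //= nuK // Kmul; split=> //; lra.
- move=> t s t01 s01 ts; rewrite /g; case: (leP t e) => te; case: (leP s e) => se.
  + exact: divle.
  + by have := half _ te; have := divgt _ (nu_lt _ s01 se); lra.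
  + lra.
  + by rewrite lerB // divle // nuanti.
- move=> u v u01 v01 uv; rewrite /h; case: (leP u 2^-1) => u2; case: (leP v 2^-1) => v2.
  + by rewrite ler_pM2l //; lra.
  + have := le_e _ u01 u2; have /andP[h0 he] := lt_e _ v01 v2.
    have w01 : 0 <= 2 * e * (1 - v) <= 1 by lra.
    by have := nu_gt _ w01 he; lra.
  + lra.
  + have := lt_e _ u01 u2; have := lt_e _ v01 v2 => ? ?.
    by apply: nuanti; [lra | lra | rewrite ler_pM2l; lra].
Qed.

(** * Conjugacy on L_n *)

Definition lift_fun (R : realType) (n : nat) (g : R -> R) (x : Ln R n) : Ln R n :=
  mkLn (fun i => g (proj i x)).

Lemma proj_lift_fun (R : realType) (n : nat) (g : R -> R) (x : Ln R n) i :
  (forall t, 0 <= t <= 1 -> 0 <= g t <= 1) ->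
  (forall t s, 0 <= t <= 1 -> 0 <= s <= 1 -> t <= s -> g t <= g s) ->
  proj i (lift_fun g x) = g (proj i x).
Proof.
move=> g01 gh; rewrite proj_mkLn // => [j|j k jk]; first exact/g01/proj01.
by rewrite gh ?proj01 // proj_mono.
Qed.

Lemma strong_negation_conjugate (R : realType) (n : nat)
    (N : Ln R n.+1 -> Ln R n.+1) :
  strong_fuzzy_negation N ->
  exists phi : Ln R n.+1 -> Ln R n.+1,
    Ln_automorphism phi /\ is_conjugate (@standard_negation R n.+1) phi N.
Proof.
move=> sN; have [nu nuE] := strong_negation_coord sN.
have [[_ _ Nanti] NK] := sN.
(* Constant vectors transfer the laws of [N] to [nu], since reversing the indices leaves them
   unchanged. *)
have nuD t (t01 : 0 <= t <= 1) k : proj k (N (diag n.+1 t01)) = nu t.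
  by rewrite nuE proj_diag.
have nu01 t : 0 <= t <= 1 -> 0 <= nu t <= 1.
  by move=> t01; rewrite -(nuD t t01 ord0) proj01.
have nuanti t s : 0 <= t <= 1 -> 0 <= s <= 1 -> t <= s -> nu s <= nu t.
  move=> t01 s01 ts; rewrite -(nuD t t01 ord0) -(nuD s s01 ord0).
  by apply/Ln_leP/Nanti/Ln_leP => i; rewrite !proj_diag.
have nuK t : 0 <= t <= 1 -> nu (nu t) = t.
  by move=> t01; rewrite -(nuD t t01 (rev_ord ord0)) -nuE NK proj_diag.
have [g [h [gP hP gh hh]]] := trillas nu01 nuanti nuK.
have g01 t : 0 <= t <= 1 -> 0 <= g t <= 1 by move=> /gP[].
have h01 t : 0 <= t <= 1 -> 0 <= h t <= 1 by move=> /hP[].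
have pg i x : proj i (@lift_fun R n.+1 g x) = g (proj i x) by exact: proj_lift_fun.
have ph i x : proj i (@lift_fun R n.+1 h x) = h (proj i x) by exact: proj_lift_fun.
have gK : cancel (@lift_fun R n.+1 g) (lift_fun h).
  by move=> x; apply: Ln_eqP => i; rewrite ph pg; case: (gP _ (proj01 x i)).
have hK : cancel (@lift_fun R n.+1 h) (lift_fun g).
  by move=> x; apply: Ln_eqP => i; rewrite pg ph; case: (hP _ (proj01 x i)).
have homg x y : (x <= y)%O -> (@lift_fun R n.+1 g x <= lift_fun g y)%O.
  by move=> /Ln_leP xy; apply/Ln_leP => i; rewrite !pg gh ?proj01.
have homh x y : (x <= y)%O -> (@lift_fun R n.+1 h x <= lift_fun h y)%O.
  by move=> /Ln_leP xy; apply/Ln_leP => i; rewrite !ph hh ?proj01.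
exists (lift_fun g); split.
  split; first by exists (lift_fun h).
  by move=> x y; split=> [/homg|/homh] //; rewrite !gK.
(* After applying [lift_fun g] to both sides, the claim is [g (nu t) = 1 - g t] in each
   coordinate. *)
exists (lift_fun h); split=> // x; apply: (can_inj gK); rewrite hK.
apply: Ln_eqP => i; rewrite pg nuE proj_standard_negation pg.
by case: (gP _ (proj01 x (rev_ord i))).
Qed.

(** Conjugation keeps the map antitone and involutive, and an antitone involution exchanges the
    least and the greatest element. *)
Lemma conjugate_strong_negation (R : realType) (n : nat)
    (phi N : Ln R n -> Ln R n) :
  Ln_automorphism phi -> is_conjugate (@standard_negation R n) phi N ->
  strong_fuzzy_negation N.
Proof.
move=> [_ phi_le] [psi [phiK psiK NE]].
have Nanti x y : (x <= y)%O -> (N y <= N x)%O.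
  move=> xy; rewrite !NE; apply/phi_le; rewrite !psiK.
  exact/standard_negation_anti/(proj1 (phi_le x y)).
have NK x : N (N x) = x by rewrite !NE psiK standard_negationK phiK.
split=> //; split=> //; apply/le_anti/andP; split.
- exact: le_Ln_one.
- by rewrite -[X in (X <= _)%O]NK; apply/Nanti/Ln_zero_le.
- by rewrite -[X in (_ <= X)%O]NK; apply/Nanti/le_Ln_one.
- exact: Ln_zero_le.
Qed.

Theorem theorem36 (R : realType) (n : nat) (n_ge1 : (1 <= n)%N)
    (N : Ln R n -> Ln R n) :
  strong_fuzzy_negation N <->
  exists phi : Ln R n -> Ln R n,
    Ln_automorphism phi /\ is_conjugate (@standard_negation R n) phi N.
Proof.
split; last by case=> phi [phi_aut NE]; exact: conjugate_strong_negation phi_aut NE.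
by case: n n_ge1 N => // n _ N; exact: strong_negation_conjugate.
Qed.
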